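(* $\mathsf{MS4.t}$ has the finite model property: every $\mathcal L_{T\forall}$-formula $\varphi$ with $\mathsf{MS4.t}\nvdash\varphi$ is refuted on some finite $\mathsf{MS4.t}$-algebra.
   Context: **MS4.t.** $\mathcal L_{T\forall}$ is the classical propositional language with unary modalities $\Box_F,\Box_P,\forall$; $\Diamond_F:=\neg\Box_F\neg$, $\Diamond_P:=\neg\Box_P\neg$, $\exists:=\neg\forall\neg$. $\mathsf{MS4.t}$ is the least set of $\mathcal L_{T\forall}$-formulas containing all classical tautologies; the $\mathsf{S4}$-axioms $\blacksquare(p\to q)\to(\blacksquare p\to\blacksquare q)$, $\blacksquare p\to p$, $\blacksquare p\to\blacksquare\blacksquare p$ for each $\blacksquare\in\{\Box_F,\Box_P\}$; the tense axioms $p\to\Box_P\Diamond_F p$ and $p\to\Box_F\Diamond_P p$; the $\mathsf{S5}$-axioms for $\forall$ (the $\mathsf{S4}$-axioms for $\forall$ together with $p\to\forall\exists p$); the axiom $\Box_F\forall p\to\forall\Box_F p$; and closed under modus ponens, substitution, and necessitation for $\Box_F,\Box_P,\forall$. **Algebras.** An interior operator on a boolean algebra $B$ is a map $\mathsf i:B\to B$ with $\mathsf i(a\wedge b)=\mathsf ia\wedge\mathsf ib$, $\mathsf i1=1$, $\mathsf ia\le a$, $\mathsf ia\le\mathsf{ii}a$. An $\mathsf{MS4.t}$-algebra is a tuple $(B,\Box_F,\Box_P,\forall)$ where $B$ is a boolean algebra, $\Box_F,\Box_P,\forall$ are interior operators on $B$, and for all $a\in B$ (with $\Diamond_F=\neg\Box_F\neg$,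 $\Diamond_P=\neg\Box_P\neg$, $\exists=\neg\forall\neg$): $a\le\Box_P\Diamond_F a$, $a\le\Box_F\Diamond_P a$, $a\le\forall\exists a$, and $\Box_F\forall a\le\forall\Box_F a$. A formula $\varphi$ is refuted on an algebra if there is an assignment of elements of the algebra to the propositional letters under which $\varphi$ (connectives and modalities interpreted by the corresponding operations) takes a value different from $1$. *)

(* Defs.v *)
From mathcomp Require Import all_boot all_order.

Set Implicit Arguments.
Unset Strict Implicit.
Unset Printing Implicit Defensive.

Import Order.TTheory.
Local Open Scope order_scope.

Inductive modality : Type := Future | Past | Univ.

Inductive form : Type :=
| Var (n : nat)
| Bot
| Neg (f : form)
| And (f g : form)
| Or (f g : form)
| Imp (f g : form)
| Box (m : modality) (f : form).

Definition Dia (m : modality) (f : form) : form := Neg (Box m (Neg f)).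

Fixpoint subst (s : nat -> form) (f : form) : form :=
  match f with
  | Var n => s n
  | Bot => Bot
  | Neg g => Neg (subst s g)
  | And g h => And (subst s g) (subst s h)
  | Or g h => Or (subst s g) (subst s h)
  | Imp g h => Imp (subst s g) (subst s h)
  | Box m g => Box m (subst s g)
  end.

(* Propositional truth value of [f] when the letters and the formulas
   [Box m g], taken as atoms, get their truth values from [v]. *)
Fixpoint truth (v : form -> bool) (f : form) : bool :=
  match f with
  | Var _ | Box _ _ => v f
  | Bot => false
  | Neg g => ~~ truth v g
  | And g h => truth v g && truth v h
  | Or g h => truth v g || truth v h
  | Imp g h => truth v g ==> truth v h
  end.

Definition tautology (f : form) : Prop := forall v : form -> bool, truth v f.

(* Axioms are stated for the fixed letters [p] and [q]; their instances come
   from the substitution rule [MS4t_subst]. *)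
Local Notation p := (Var 0).
Local Notation q := (Var 1).

Inductive MS4t : form -> Prop :=
| MS4t_taut f : tautology f -> MS4t f
| MS4t_K m : MS4t (Imp (Box m (Imp p q)) (Imp (Box m p) (Box m q)))
| MS4t_T m : MS4t (Imp (Box m p) p)
| MS4t_4 m : MS4t (Imp (Box m p) (Box m (Box m p)))
| MS4t_past_future : MS4t (Imp p (Box Past (Dia Future p)))
| MS4t_future_past : MS4t (Imp p (Box Future (Dia Past p)))
| MS4t_B : MS4t (Imp p (Box Univ (Dia Univ p)))
| MS4t_com : MS4t (Imp (Box Future (Box Univ p)) (Box Univ (Box Future p)))
| MS4t_mp f g : MS4t (Imp f g) -> MS4t f -> MS4t g
| MS4t_subst s f : MS4t f -> MS4t (subst s f)
| MS4t_nec m f : MS4t f -> MS4t (Box m f).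

Record interior_operator d (B : ctbDistrLatticeType d) (i : B -> B) : Prop := {
  interior_meet : forall a b, i (a `&` b) = i a `&` i b;
  interior_top : i \top = \top;
  interior_le : forall a, i a <= a;
  interior_idem : forall a, i a <= i (i a)
}.

Definition dual_op d (B : ctbDistrLatticeType d) (i : B -> B) : B -> B :=
  fun a => ~` (i (~` a)).

(* The operations and laws making the boolean algebra [B] an MS4.t-algebra. *)
Record MS4t_algebra d (B : ctbDistrLatticeType d) : Type := {
  boxF : B -> B;
  boxP : B -> B;
  univ : B -> B;
  boxF_interior : interior_operator boxF;
  boxP_interior : interior_operator boxP;
  univ_interior : interior_operator univ;
  le_boxP_diaF : forall a, a <= boxP (dual_op boxF a);
  le_boxF_diaP : forall a, a <= boxF (dual_op boxP a);
  le_univ_exist : forall a, a <= univ (dual_op univ a);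
  boxF_univ_le : forall a, boxF (univ a) <= univ (boxF a)
}.

Definition box_op d (B : ctbDistrLatticeType d) (A : MS4t_algebra B)
    (m : modality) : B -> B :=
  match m with Future => boxF A | Past => boxP A | Univ => univ A end.

Fixpoint eval d (B : ctbDistrLatticeType d) (A : MS4t_algebra B)
    (v : nat -> B) (f : form) : B :=
  match f with
  | Var n => v n
  | Bot => \bot
  | Neg g => ~` (eval A v g)
  | And g h => eval A v g `&` eval A v h
  | Or g h => eval A v g `|` eval A v h
  | Imp g h => ~` (eval A v g) `|` eval A v h
  | Box m g => box_op A m (eval A v g)
  end.

Definition refuted_on d (B : ctbDistrLatticeType d) (A : MS4t_algebra B)
    (f : form) : Prop :=
  exists v : nat -> B, eval A v f <> \top.

(* Main.v *)
Require Import Defs.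
From HB Require Import structures.
From mathcomp Require Import boolp classical_sets.
From mathcomp Require Import all_boot all_order.

(** A formula that is not derivable fails at a point of the canonical model,
    and a suitable filtration makes that model finite and keeps the refutation.

    The points of the canonical model are the propositional valuations that
    make every theorem true ([point]); they exist in abundance by Zorn's lemma
    ([point_exists]).  For each modality [m] the canonical relation [can m] is a
    preorder; [can Past] is the converse of [can Future], [can Univ] is
    symmetric, and the axiom BoxF All p -> All BoxF p yields the commutation
    property: [can Univ] followed by [can Future] is included in [can Future]
    followed by [can Univ] ([can_com]).

    A plain filtration by the subformulas of [phi] need not keep the commutation
    property.  So a point [x] is sent to the pair [cell x] consisting of its
    type (which subformulas hold at [x]) and of the set of types of the points
    equivalent to [x] for [can Univ].  If [y] and [z] have the same cell, then
    every point equivalent to [y] has the cell of some point equivalent to [z],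
    which is exactly what makes the commutation property survive
    ([quo_com]).  The relations between the cells are the reflexive transitive
    closures of the images of the canonical relations; taking closures is
    harmless for the truth lemma ([mem_eval_cell]) since, by transitivity of
    [can m], a true formula [Box m f] propagates along steps.

    The powerset of the finite set of cells, with the box operations of the
    three relations, is then a finite MS4.t-algebra that refutes [phi]. *)

Set Implicit Arguments.
Unset Strict Implicit.
Unset Printing Implicit Defensive.

Import Order.SetSubsetOrder Order.DefaultSetSubsetOrder.

(** * Complex algebra of a finite frame *)

(** A finite Kripke frame for MS4.t: a preorder for the future, its converse for
    the past, and an equivalence relation that satisfies the commutation
    property [fr_com]. *)
Record frame (W : finType) := Frame {
  fr_rel : modality -> rel W;
  fr_refl : forall m, reflexive (fr_rel m);
  fr_trans : forall m, transitive (fr_rel m);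
  fr_converse : forall a b, fr_rel Past a b = fr_rel Future b a;
  fr_univ_sym : symmetric (fr_rel Univ);
  fr_com : forall a b c, fr_rel Univ a b -> fr_rel Future b c ->
    exists2 d, fr_rel Future a d & fr_rel Univ d c
}.

(** The points all of whose [r]-successors lie in [U]. *)
Definition box_set (W : finType) (r : rel W) (U : {set W}) : {set W} :=
  [set a | [forall b, r a b ==> (b \in U)]].

Section ComplexAlgebra.

Variable (W : finType).
Implicit Types (r : rel W) (U : {set W}).

Lemma box_setP r U a :
  reflect (forall b, r a b -> b \in U) (a \in box_set r U).
Proof.
rewrite inE; apply: (iffP forallP) => rU b; first exact/implyP.
by apply/implyP/rU.
Qed.

Lemma box_set_interior r : reflexive r -> transitive r ->
  interior_operator (@box_set W r).
Proof.
move=> r_refl r_trans; split.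
- move=> U V; rewrite !meetEsubset; apply/setP => a; rewrite in_setI.
  apply/box_setP/andP => [rUV|[/box_setP rU /box_setP rV] b rab].
    by split; apply/box_setP => b /rUV; rewrite in_setI => /andP[].
  by rewrite in_setI rU ?rV.
- rewrite topEsubset; apply/setP => a; rewrite in_setT.
  by apply/box_setP => b _; rewrite in_setT.
- by move=> U; apply/subsetP => a /box_setP; apply.
- move=> U; apply/subsetP => a /box_setP rU; apply/box_setP => b rab.
  by apply/box_setP => c rbc; apply: rU; apply: r_trans rbc.
Qed.

(** One half of the adjunction between the box of a relation and the diamond of
    its converse. *)
Lemma le_box_set_dual r r' (U : {set W}) : (forall a b, r a b -> r' b a) ->
  (U <= box_set r (dual_op (@box_set W r') U))%O.
Proof.
move=> rr'; apply/subsetP => a aU; apply/box_setP => b rab.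
rewrite /dual_op !complEsubset in_setC; apply/box_setP => /(_ a (rr' _ _ rab)).
by rewrite in_setC aU.
Qed.

Variable F : frame W.

Lemma box_set_com (U : {set W}) :
  (box_set (fr_rel F Future) (box_set (fr_rel F Univ) U)
     <= box_set (fr_rel F Univ) (box_set (fr_rel F Future) U))%O.
Proof.
apply/subsetP => a /box_setP aU; apply/box_setP => b ab; apply/box_setP => c bc.
by have [d ad dc] := fr_com ab bc; have /box_setP := aU _ ad; apply.
Qed.

(** The powerset of [W], ordered by inclusion, with the box operations of the
    three relations of the frame. *)
Definition complex_algebra : MS4t_algebra {set W} :=
  {| boxF := box_set (fr_rel F Future);
     boxP := box_set (fr_rel F Past);
     univ := box_set (fr_rel F Univ);
     boxF_interior :=
       box_set_interior (@fr_refl _ F Future) (@fr_trans _ F Future);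
     boxP_interior :=
       box_set_interior (@fr_refl _ F Past) (@fr_trans _ F Past);
     univ_interior :=
       box_set_interior (@fr_refl _ F Univ) (@fr_trans _ F Univ);
     le_boxP_diaF := fun U => le_box_set_dual U
       (fun a b => etrans (esym (fr_converse F a b)));
     le_boxF_diaP := fun U => le_box_set_dual U
       (fun a b => etrans (fr_converse F b a));
     le_univ_exist := fun U => le_box_set_dual U
       (fun a b => etrans (fr_univ_sym F b a));
     boxF_univ_le := box_set_com |}.

Lemma box_op_complex m U :
  box_op complex_algebra m U = box_set (fr_rel F m) U.
Proof. by case: m. Qed.

End ComplexAlgebra.

(** * Derivations in MS4.t *)

Local Notation Top := (Imp Bot Bot).

(* Instances of the axioms. *)
Section Instances.

Implicit Types f g h : form.

Let inst f g : nat -> form := fun n => if n is 0 then f else g.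

Lemma MS4t_Kf m f g :
  MS4t (Imp (Box m (Imp f g)) (Imp (Box m f) (Box m g))).
Proof. exact: (MS4t_subst (inst f g) (MS4t_K m)). Qed.

Lemma MS4t_Tf m f : MS4t (Imp (Box m f) f).
Proof. exact: (MS4t_subst (inst f f) (MS4t_T m)). Qed.

Lemma MS4t_4f m f : MS4t (Imp (Box m f) (Box m (Box m f))).
Proof. exact: (MS4t_subst (inst f f) (MS4t_4 m)). Qed.

Lemma MS4t_past_futuref f : MS4t (Imp f (Box Past (Dia Future f))).
Proof. exact: (MS4t_subst (inst f f) MS4t_past_future). Qed.

Lemma MS4t_future_pastf f : MS4t (Imp f (Box Future (Dia Past f))).
Proof. exact: (MS4t_subst (inst f f) MS4t_future_past). Qed.

Lemma MS4t_Bf f : MS4t (Imp f (Box Univ (Dia Univ f))).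
Proof. exact: (MS4t_subst (inst f f) MS4t_B). Qed.

Lemma MS4t_comf f :
  MS4t (Imp (Box Future (Box Univ f)) (Box Univ (Box Future f))).
Proof. exact: (MS4t_subst (inst f f) MS4t_com). Qed.

Lemma MS4t_monotone m f g : MS4t (Imp f g) -> MS4t (Imp (Box m f) (Box m g)).
Proof. by move=> fg; apply: MS4t_mp (MS4t_Kf m f g) _; apply: MS4t_nec. Qed.

End Instances.

(** [derives G f]: [f] follows from theorems and from formulas in [G] by modus
    ponens alone; necessitation is not applied to the hypotheses in [G]. *)
Inductive derives (G : form -> Prop) : form -> Prop :=
| derives_hyp f : G f -> derives G f
| derives_thm f : MS4t f -> derives G f
| derives_mp f g : derives G (Imp f g) -> derives G f -> derives G g.

Section Derives.

Implicit Types (G H : form -> Prop) (f g h : form).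

Lemma derives_taut G f : tautology f -> derives G f.
Proof. by move=> ft; apply/derives_thm/MS4t_taut. Qed.

Lemma derives_sub G H f :
  (forall g, G g -> derives H g) -> derives G f -> derives H f.
Proof.
move=> GH; elim=> [g /GH //|g /derives_thm //|g h _ IHgh _ IHg].
exact: derives_mp IHgh IHg.
Qed.

Lemma derives_none G f : (forall g, ~ G g) -> derives G f -> MS4t f.
Proof. by move=> G0; elim=> [g /G0|//|g h _ + _]; last exact: MS4t_mp. Qed.

Lemma deduction G f g :
  derives (fun h => G h \/ h = f) g -> derives G (Imp f g).
Proof.
have weaken h : derives G h -> derives G (Imp f h).
  apply: derives_mp; apply: derives_taut => v /=.
  by case: (truth v h); rewrite ?implybT.
elim=> [h [/derives_hyp/weaken // | ->] | h /derives_thm/weaken // |].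
  by apply: derives_taut => v /=; rewrite implybb.
move=> h k _ IHhk _; apply: derives_mp; apply: derives_mp IHhk.
by apply: derives_taut => v /=; do 3!case: (truth v _).
Qed.

(** Compactness along a chain. *)
Lemma derives_chain (C : (form -> Prop) -> Prop) G f :
    total_on C classical_sets.subset ->
    derives (fun h => G h \/ exists2 A, C A & A h) f ->
  derives G f \/ exists2 A, C A & derives (fun h => G h \/ A h) f.
Proof.
move=> totC; elim=> [h [Gh | [A CA Ah]] | h /derives_thm-Dh | h k _ IHhk _ IHh].
- by left; apply: derives_hyp.
- by right; exists A => //; apply: derives_hyp; right.
- by left.
have extend A g : derives G g -> derives (fun h => G h \/ A h) g.
  by apply: derives_sub => ? ?; apply: derives_hyp; left.
have widen A B g : (forall h, A h -> B h) ->
    derives (fun h => G h \/ A h) g -> derives (fun h => G h \/ B h) g.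
  move=> AB; apply: derives_sub => l Gl; apply: derives_hyp.
  by case: Gl => [|/AB]; [left | right].
case: IHhk IHh => [Dhk | [A CA Dhk]] [Dh | [B CB Dh]].
- by left; apply: derives_mp Dh.
- by right; exists B => //; apply: derives_mp (extend _ _ Dhk) Dh.
- by right; exists A => //; apply: derives_mp Dhk (extend _ _ Dh).
have [AB | BA] := totC _ _ CA CB; right.
  by exists B => //; apply: derives_mp Dh; apply: widen Dhk.
by exists A => //; apply: derives_mp Dhk _; apply: widen Dh.
Qed.

End Derives.

(** * Canonical model *)

(** A valuation of the letters and boxed formulas that makes all theorems true;
    the formulas that it makes true form a maximal consistent set, and every
    maximal consistent set arises so. *)
Record point := Point {
  pt_val :> form -> bool;
  pt_thm : forall f, MS4t f -> truth pt_val f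
}.

Lemma pt_imp (x : point) f g : MS4t (Imp f g) -> truth x f -> truth x g.
Proof. by move/(pt_thm x)/implyP. Qed.

(** Lindenbaum's lemma. *)
Lemma point_exists (G : form -> Prop) f : ~ derives G f ->
  exists x : point, (forall g, G g -> truth x g) /\ ~~ truth x f.
Proof.
move=> nGf.
pose ok (A : form -> Prop) := ~ derives (fun h => G h \/ A h) f.
have [|A [okA maxA]] := @Zorn_bigcup form ok.
  move=> C okC totC; rewrite /ok => DC.
  by have [|[A /okC]] := derives_chain totC DC.
pose M h := derives (fun h => G h \/ A h) h.
(* By maximality, adding an underivable formula makes [f] derivable. *)
have maxM h : ~ M h -> M (Imp h f).
  move=> nMh; apply: deduction; apply: contrapT => nDf.
  apply: (maxA (fun k => A k \/ k = h)).
    split=> [k Ak|AhA]; first by left.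
    by apply: nMh; apply: derives_hyp; right; apply: AhA; right.
  move=> Df; apply: nDf; apply: derives_sub Df => k Gk.
  by apply: derives_hyp; tauto.
have M_neg h : M (Neg h) <-> ~ M h.
  split=> [Mnh Mh | /maxM Mhf].
    apply: okA; apply: derives_mp Mh; apply: derives_mp Mnh.
    by apply: derives_taut => v /=; case: (truth v h).
  apply: contrapT => /maxM Mnhf; apply: okA; apply: derives_mp Mnhf.
  by apply: derives_mp Mhf; apply: derives_taut => v /=; do 2!case: (truth v _).
pose v h := `[< M h >].
have vM h : truth v h <-> M h.
  elim: h => [n||h IHh|h IHh k IHk|h IHh k IHk|h IHh k IHk|m h _] /=.
  - by split=> /asboolP.
  - split=> // MB; case: okA; apply: derives_mp MB.
    by apply: derives_taut.
  - rewrite M_neg -IHh; split; first by move/negP.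
    by move=> ?; apply/negP.
  - split=> [/andP[/IHh Mh /IHk] | Mhk].
      apply: derives_mp; apply: derives_mp Mh.
      by apply: derives_taut => w /=; do 2!case: (truth w _).
    by rewrite (IHh.2 _) ?(IHk.2 _) //; apply: derives_mp Mhk;
      apply: derives_taut => w /=; do 2!case: (truth w _).
  - split=> [/orP[/IHh|/IHk] | Mhk].
    + by apply: derives_mp; apply: derives_taut => w /=; do 2!case: (truth w _).
    + by apply: derives_mp; apply: derives_taut => w /=; do 2!case: (truth w _).
    apply/orP; have [/IHh | /M_neg Mnh] := pselect (M h); first by left.
    right; apply/IHk; apply: derives_mp Mnh; apply: derives_mp Mhk.
    by apply: derives_taut => w /=; do 2!case: (truth w _).
  - split=> [hk | Mhk]; last by apply/implyP => /IHh Mh; apply/IHk/(derives_mp Mhk).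
    have [/IHh Mh | /M_neg] := pselect (M h).
      move: hk; rewrite Mh => /IHk.
      by apply: derives_mp; apply: derives_taut => w /=; do 2!case: (truth w _).
    by apply: derives_mp; apply: derives_taut => w /=; do 2!case: (truth w _).
  - by split=> /asboolP.
have v_thm h : MS4t h -> truth v h by move=> Th; apply/vM/derives_thm.
exists (Point v_thm); split=> [g Gg | /=]; last by apply/negP => /vM.
by apply/vM/derives_hyp; left.
Qed.

(** The canonical accessibility relation of the modality [m]. *)
Definition can (m : modality) (x y : point) : Prop :=
  forall f, truth x (Box m f) -> truth y f.

Section Canonical.

Implicit Types (x y z : point) (f g : form).

Lemma can_refl m x : can m x x.
Proof. by move=> f; apply: pt_imp (MS4t_Tf m f). Qed.

Lemma can_box m x y f : can m x y -> truth x (Box m f) -> truth y (Box m f).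
Proof. by move=> xy /(pt_imp (MS4t_4f m f))/xy. Qed.

Lemma can_trans m x y z : can m x y -> can m y z -> can m x z.
Proof. by move=> xy yz f /(can_box xy)/yz. Qed.

(** An axiom f -> Box m (Dia n f) makes [can n] include the converse of
    [can m]. *)
Lemma can_converse m n : (forall f, MS4t (Imp f (Box m (Dia n f)))) ->
  forall x y, can m x y -> can n y x.
Proof.
move=> ax x y xy f yf; apply/negPn/negP => nxf.
have /xy : truth x (Box m (Dia n (Neg f))) by apply: pt_imp (ax _) _.
rewrite [truth _ _]/= => /negP; apply.
have ff : MS4t (Imp f (Neg (Neg f))).
  by apply: MS4t_taut => v /=; rewrite negbK implybb.
exact: pt_imp (MS4t_monotone n ff) yf.
Qed.

Lemma can_past_future x y : can Past x y <-> can Future y x.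
Proof.
split; apply: can_converse.
  exact: MS4t_past_futuref.
exact: MS4t_future_pastf.
Qed.

Lemma can_univ_sym x y : can Univ x y -> can Univ y x.
Proof. exact/can_converse/MS4t_Bf. Qed.

Lemma can_exists m x f : ~~ truth x (Box m f) ->
  exists2 y, can m x y & ~~ truth y f.
Proof.
move=> nxf; have [|y [xy nyf]] := @point_exists (fun g => truth x (Box m g)) f.
  move=> Df; case/negP: nxf; elim: Df => [//|g Tg|g h _ IHgh _].
    by apply: pt_thm; apply: MS4t_nec.
  by apply/implyP; apply: pt_imp (MS4t_Kf m g h) IHgh.
by exists y.
Qed.

Lemma MS4t_univ5 f : MS4t (Imp (Neg (Box Univ f)) (Box Univ (Neg (Box Univ f)))).
Proof.
apply: MS4t_mp (MS4t_Bf (Neg (Box Univ f))).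
have /(MS4t_monotone Univ) T :
    MS4t (Imp (Dia Univ (Neg (Box Univ f))) (Neg (Box Univ f))).
  have nn : MS4t (Imp (Box Univ f) (Neg (Neg (Box Univ f)))).
    by apply: MS4t_taut => v /=; rewrite negbK implybb.
  apply: MS4t_mp (MS4t_mp (MS4t_taut _) (MS4t_4f Univ f)) (MS4t_monotone Univ nn).
  by move=> v /=; do 3!case: (v _).
apply: MS4t_mp T; apply: MS4t_taut => v /=.
by do 3!case: (v _).
Qed.

(** The point [u] is obtained from the set [G] of the formulas that it has to
    satisfy.  If [G] were inconsistent, [Box Future (Neg (Box Univ b))] would
    hold at [x] for some [b] with [Box Univ b] true at [z]; by S5 and the axiom
    BoxF All p -> All BoxF p, [Box Univ b] would then fail at [z]. *)
Lemma can_com x y z : can Univ x y -> can Future y z ->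
  exists2 u, can Future x u & can Univ u z.
Proof.
move=> xy yz.
pose G f := truth x (Box Future f) \/
  exists2 g, truth z (Box Univ g) & f = Box Univ g.
(* A derivation uses finitely many of the formulas [Box Univ g] true at [z];
   [b] is the conjunction of these [g]. *)
have DG f : derives G f -> exists2 b, truth z (Box Univ b) &
    truth x (Box Future (Imp (Box Univ b) f)).
  have weaken g : truth x (Box Future g) ->
      exists2 b, truth z (Box Univ b) & truth x (Box Future (Imp (Box Univ b) g)).
    move=> xg; exists Top; first by apply/pt_thm/MS4t_nec/MS4t_taut.
    apply: pt_imp xg; apply/MS4t_monotone/MS4t_taut => v /=.
    by case: (truth v g); rewrite ?implybT.
  elim=> [g [/weaken //|[b zb ->]] | g Tg | g h _ [b zb xgh] _ [c zc xg]].
  - exists b => //; apply/pt_thm/MS4t_nec/MS4t_taut => v /=.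
    by rewrite implybb.
  - by apply/weaken/pt_thm/MS4t_nec.
  have bcl : MS4t (Imp (Box Univ (And b c)) (Box Univ b)).
    by apply/MS4t_monotone/MS4t_taut => v /=; do 2!case: (truth v _).
  have bcr : MS4t (Imp (Box Univ (And b c)) (Box Univ c)).
    by apply/MS4t_monotone/MS4t_taut => v /=; do 2!case: (truth v _).
  exists (And b c).
    have : truth z (Box Univ (Imp c (And b c))).
      apply: pt_imp zb; apply/MS4t_monotone/MS4t_taut => v /=.
      by do 2!case: (truth v _).
    by move/(pt_imp (MS4t_Kf _ _ _))/implyP; apply.
  have step : MS4t (Imp (Imp (Box Univ b) (Imp g h))
      (Imp (Imp (Box Univ c) g) (Imp (Box Univ (And b c)) h))).
    apply: MS4t_mp bcr; apply: MS4t_mp bcl; apply: MS4t_taut => v /=.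
    by do 3!case: (v _); do 2!case: (truth v _).
  have /(pt_imp (MS4t_Kf _ _ _))/implyP := pt_imp (MS4t_monotone Future step) xgh.
  exact.
have [/DG[b zb xb]|u [Gu _]] := @point_exists G Bot.
  have : truth x (Box Future (Box Univ (Neg (Box Univ b)))).
    apply: pt_imp xb; apply: MS4t_monotone; apply: MS4t_mp (MS4t_univ5 b).
    by apply: MS4t_taut => v /=; do 2!case: (v _).
  move/(pt_imp (MS4t_comf _))/xy/yz.
  by rewrite [truth _ _]/= => /negP; case.
exists u; first by move=> f xf; apply: Gu; left.
apply: can_univ_sym => f zf; apply: (can_refl (m := Univ)).
by apply: Gu; right; exists f.
Qed.

End Canonical.

(** * Filtration *)

(* Classical decidable equality of formulas. *)
HB.instance Definition _ := gen_eqMixin form.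

Fixpoint subforms (f : form) : seq form :=
  f :: match f with
       | Var _ | Bot => [::]
       | Neg g | Box _ g => subforms g
       | And g h | Or g h | Imp g h => subforms g ++ subforms h
       end.

Lemma mem_subforms f : f \in subforms f.
Proof. by case: f => *; rewrite /= inE eqxx. Qed.

Section Filtration.

Variable phi : form.
Implicit Types (x y z : point) (m : modality) (f : form).

Let Sigma := subforms phi.

(** The type of [x]: the truth values at [x] of the subformulas of [phi]. *)
Definition ptype x : (size Sigma).-tuple bool :=
  map_tuple (truth x) (in_tuple Sigma).

(** Pairs of a type and of a set of types. Those that are not the cell of any
    point are kept: no step enters or leaves them. *)
Definition cell_type : finType :=
  ((size Sigma).-tuple bool * {set (size Sigma).-tuple bool})%type.

(** The type of [x] with the types of the points equivalent to [x]. *)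
Definition cell x : cell_type :=
  (ptype x, [set t | `[< exists2 y, can Univ x y & ptype y = t >]]).

Lemma cell_truth x y f : cell x = cell y -> f \in Sigma ->
  truth x f = truth y f.
Proof. by case=> /eq_in_map xy _ /xy. Qed.

Lemma cell_univ2 x y : can Univ x y -> (cell x).2 = (cell y).2.
Proof.
move=> Exy; apply/setP => t; rewrite !inE.
apply: asbool_equiv_eq; split=> -[z Ez <-]; exists z => //.
  by apply: can_trans Ez; apply: can_univ_sym.
exact: can_trans Ez.
Qed.

(** The set of types in a cell determines the equivalent cells. *)
Lemma cell_univ x y z : can Univ x y -> cell y = cell z ->
  exists2 u, cell u = cell x & can Univ u z.
Proof.
move=> Exy yz; have Txz : (cell x).2 = (cell z).2.
  by rewrite (cell_univ2 Exy) yz.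
have : ptype x \in (cell x).2.
  by rewrite inE; apply/asboolP; exists x => //; apply: can_refl.
rewrite Txz inE => /asboolP[u /can_univ_sym Euz ux].
exists u => //; rewrite [LHS]surjective_pairing [RHS]surjective_pairing.
by rewrite (cell_univ2 Euz) Txz /= ux.
Qed.

(** The image of [can m] under [cell]. *)
Definition step m : rel cell_type := fun a b =>
  `[< exists x y, [/\ can m x y, cell x = a & cell y = b] >].

(** The accessibility relation between cells: the image of [can m] need not be
    transitive, hence the closure. *)
Definition quo m : rel cell_type := connect (step m).

Lemma stepP m a b :
  reflect (exists x y, [/\ can m x y, cell x = a & cell y = b]) (step m a b).
Proof. exact: asboolP. Qed.

Lemma quo_cell m x y : can m x y -> quo m (cell x) (cell y).
Proof. by move=> xy; apply: connect1; apply/stepP; exists x, y. Qed.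

Lemma quo_refl m : reflexive (quo m).
Proof. exact: connect0. Qed.

Lemma quo_trans m : transitive (quo m).
Proof. exact: connect_trans. Qed.

Lemma quo_converse a b : quo Past a b = quo Future b a.
Proof.
transitivity (connect [rel c d | step Future d c] a b); last exact: connect_rev.
apply: eq_connect => {}a {}b; apply/stepP/stepP => -[x [y [xy xa yb]]].
  by exists y, x; split=> //; apply/can_past_future.
by exists y, x; split=> //; apply/can_past_future.
Qed.

Lemma quo_univ_sym : symmetric (quo Univ).
Proof.
apply: sym_connect_sym => a b; apply/stepP/stepP => -[x [y [xy xa yb]]];
  by exists y, x; split=> //; apply: can_univ_sym.
Qed.

Lemma step_com a b c : step Univ a b -> step Future b c ->
  exists2 d, step Future a d & step Univ d c.
Proof.
move=> /stepP[x [y [xy <- <-]]] /stepP[y' [z [y'z yy' <-]]].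
have [x' <- x'y'] := cell_univ xy (esym yy').
have [u x'u uz] := can_com x'y' y'z.
by exists (cell u); apply/stepP; [exists x', u | exists u, z].
Qed.

Lemma quo_com a b c : quo Univ a b -> quo Future b c ->
  exists2 d, quo Future a d & quo Univ d c.
Proof.
(* One step for [Univ] is first moved through a whole future path. *)
have step_quo a' b' c' : step Univ a' b' -> quo Future b' c' ->
    exists2 d, quo Future a' d & step Univ d c'.
  move=> ab /connectP[s bs ->{c'}].
  elim: s a' b' ab bs => [|e s IHs] a' b' ab /=.
    by exists a' => //; apply: quo_refl.
  case/andP=> be es; have [d ad de] := step_com ab be.
  have [d' dd' d'c] := IHs _ _ de es.
  by exists d' => //; apply: quo_trans dd'; apply: connect1.
move=> /connectP[s as_ ->{b}] bc.
elim: s a as_ bc => [|e s IHs] a /=; first by exists c => //; apply: quo_refl.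
case/andP=> ae es bc; have [d ed dc] := IHs _ es bc.
have [d' ad' d'd] := step_quo _ _ _ ae ed.
by exists d' => //; apply: quo_trans dc; apply: connect1.
Qed.

Definition cell_frame : frame cell_type :=
  Frame quo_refl quo_trans quo_converse quo_univ_sym quo_com.

(** If [Box m f] holds at a point, it holds at some point of every cell that is
    reachable from the cell of that point: its truth depends on the cell only,
    and [can m] preserves it. *)
Lemma quo_box m x b f : Box m f \in Sigma -> quo m (cell x) b ->
  truth x (Box m f) -> exists2 y, cell y = b & truth y (Box m f).
Proof.
move=> Sf /connectP[s xs ->{b}]; elim: s x xs => [|e s IHs] x.
  by exists x.
rewrite [path _ _ _]/= => /andP[/stepP[x' [y [x'y x'x <-]]] ys].
by rewrite -(cell_truth x'x Sf) => /(can_box x'y); apply: IHs.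
Qed.

(** Letters hold at the cells of the points where they hold; letters that do not
    occur in [phi] get a value that plays no role. *)
Definition cell_val (n : nat) : {set cell_type} :=
  [set a | `[< exists2 x, cell x = a & truth x (Var n) >]].

(** Truth lemma. *)
Lemma mem_eval_cell f x : {subset subforms f <= Sigma} ->
  (cell x \in eval (complex_algebra cell_frame) cell_val f) = truth x f.
Proof.
elim: f x => [n||f IHf|f IHf g IHg|f IHf g IHg|f IHf g IHg|m f IHf] x sub;
  have Sf := sub _ (mem_subforms _); rewrite [eval _ _ _]/=.
- rewrite inE; apply/asboolP/idP => [[y yx]|xn]; last by exists x.
  by rewrite (cell_truth yx Sf).
- by rewrite botEsubset in_set0.
- rewrite complEsubset in_setC IHf // => h fh; apply: sub.
  by rewrite /= inE fh orbT.
- rewrite meetEsubset in_setI IHf ?IHg // => h fh; apply: sub;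
    by rewrite /= inE mem_cat fh ?orbT.
- rewrite joinEsubset in_setU IHf ?IHg // => h fh; apply: sub;
    by rewrite /= inE mem_cat fh ?orbT.
- rewrite joinEsubset complEsubset in_setU in_setC IHf ?IHg /= ?implybE //;
    by move=> h fh; apply: sub; rewrite /= inE mem_cat fh ?orbT.
have {}IHf y : (cell y \in eval (complex_algebra cell_frame) cell_val f)
    = truth y f.
  by apply: IHf => h fh; apply: sub; rewrite /= inE fh orbT.
rewrite box_op_complex; apply/box_setP/idP => [xf | xf b].
  apply/negPn/negP => /can_exists[y xy]; rewrite -IHf xf //.
  exact: (quo_cell xy).
case/(quo_box Sf)/(_ xf) => y <- /(can_refl (m := m)).
by rewrite IHf.
Qed.

End Filtration.

Theorem theorem5p2 (phi : form) (hphi : ~ MS4t phi) :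
  exists (d : Order.disp_t) (B : finCTBDistrLatticeType d)
    (A : MS4t_algebra B), refuted_on A phi.
Proof.
have [|x [_ /negP nx]] := @point_exists (fun _ => False) phi.
  by move/derives_none => /(_ (fun _ => id)).
exists _, {set cell_type phi}, (complex_algebra (cell_frame phi)).
exists (@cell_val phi) => Dphi; apply: nx.
by rewrite -(@mem_eval_cell phi) // Dphi topEsubset in_setT.
Qed.
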